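(* Let $\Lambda$ be a set of standard formulas of $\mathcal{L}_{\mathtt{CL}}$ closed under standard substitution. If $\mathcal{A}$ is an $\mathtt{inq}\Lambda$-algebra and $\mathcal{A}\nvDash^c\phi$, then there is a finite, core-generated, well-connected $\mathtt{inq}\Lambda$-algebra $\mathcal{B}$ such that $\mathcal{B}\nvDash^c\phi$.
   Context: Formulas of $\mathcal{L}_{\mathtt{CL}}$ are generated from a countable set $\mathtt{At}$ of variables by $\bot,\land,\lor,\to$; a formula is standard if it contains no $\lor$; a standard substitution replaces atoms by standard formulas. A Brouwerian semilattice is $(B,\land,\to,0)$ with $(B,\land)$ a meet-semilattice with least element $0$ and $a\land b\le c\iff a\le b\to c$. An inquisitive algebra is a first-order structure $\mathcal{A}=(A,A_c,\land,\lor,\to,0)$ with a unary predicate $A_c\subseteq A$ (the core, $\mathcal{A}_c$) such that, with $\langle\mathcal{A}_c\rangle$ the closure of $A_c$ under $\land,\lor,\to,0$, $(\langle A_c\rangle,\lor,\land,\to,0)$ is a Heyting algebra; $(A_c,\land,\to,0)$ is a Brouwerian semilattice; and $a\to(x\lor y)=(a\to x)\lor(a\to y)$ for all $a\in A_c$, $x,y\in\langle A_c\rangle$. $\mathcal{A}$ is core-generated if $A=\langle\mathcal{A}_c\rangle$, and well-connected if in $\langle\mathcal{A}_c\rangle$, $x\lor y=1$ implies $x=1$ or $y=1$. $1:=0\to0$. A core valuation is $\mu:\mathtt{At}\to A_c$, extended homomorphically to formulas; $\mathcal{A}\vDash^c\phi$ means $\phi$ evaluates to $1$ under every core valuation. An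 $\mathtt{inq}\Lambda$-algebra is an inquisitive algebra with $\mathcal{A}\vDash^c\psi$ for all $\psi\in\Lambda$. *)

(* Defs.v *)
From mathcomp Require Import all_boot.
From mathcomp Require Export boolp classical_sets cardinality.

Set Implicit Arguments.
Unset Strict Implicit.
Unset Printing Implicit Defensive.

Local Open Scope classical_set_scope.

Inductive form (At : Type) : Type :=
| Var of At
| Bot
| And of form At & form At
| Or of form At & form At
| Imp of form At & form At.

Arguments Bot {At}.

Fixpoint standard (At : Type) (phi : form At) : bool :=
  match phi with
  | Var _ | Bot => true
  | And phi1 phi2 | Imp phi1 phi2 => standard phi1 && standard phi2
  | Or _ _ => false
  end.

Fixpoint subst (At : Type) (s : At -> form At) (phi : form At) : form At :=
  match phi with
  | Var p => s p
  | Bot => Bot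
  | And phi1 phi2 => And (subst s phi1) (subst s phi2)
  | Or phi1 phi2 => Or (subst s phi1) (subst s phi2)
  | Imp phi1 phi2 => Imp (subst s phi1) (subst s phi2)
  end.

Definition standard_subst_closed (At : Type) (Lambda : set (form At)) : Prop :=
  forall s : At -> form At, (forall p, standard (s p)) ->
  forall psi, Lambda psi -> Lambda (subst s psi).

(* The algebraic notions below are relative to a subset S of a type, with
   operations defined on the whole type, because nothing is required of an
   inquisitive algebra outside the subalgebra generated by its core. *)
Section RelativeAlgebras.

Variables (T : Type) (S : set T).

Definition closed_under (op : T -> T -> T) : Prop :=
  forall x y, S x -> S y -> S (op x y).

Definition semilattice_on (op : T -> T -> T) : Prop :=
  [/\ closed_under op,
      forall x, S x -> op x x = x,
      forall x y, S x -> S y -> op x y = op y x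
    & forall x y z, S x -> S y -> S z ->
        op x (op y z) = op (op x y) z].

Definition meet_le (meet : T -> T -> T) (x y : T) : Prop := meet x y = x.

Definition brouwerian_semilattice_on (meet imp : T -> T -> T) (zero : T) :
    Prop :=
  [/\ semilattice_on meet,
      closed_under imp,
      S zero,
      forall x, S x -> meet_le meet zero x
    & forall a b c, S a -> S b -> S c ->
        meet_le meet (meet a b) c <-> meet_le meet a (imp b c)].

Definition lattice_on (join meet : T -> T -> T) : Prop :=
  [/\ semilattice_on meet,
      semilattice_on join,
      forall x y, S x -> S y -> meet x (join x y) = x
    & forall x y, S x -> S y -> join x (meet x y) = x].

(* The greatest element and distributivity follow from residuation. *)
Definition heyting_algebra_on (join meet imp : T -> T -> T) (zero : T) : Prop :=
  [/\ lattice_on join meet,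
      closed_under imp,
      S zero,
      forall x, S x -> meet_le meet zero x
    & forall a b c, S a -> S b -> S c ->
        meet_le meet (meet a b) c <-> meet_le meet a (imp b c)].

End RelativeAlgebras.

Record inq_structure : Type := InqStructure {
  carrier :> Type;
  core : set carrier;
  meet : carrier -> carrier -> carrier;
  join : carrier -> carrier -> carrier;
  imp : carrier -> carrier -> carrier;
  zero : carrier
}.

Arguments core _ : clear implicits.
Arguments meet {_}.
Arguments join {_}.
Arguments imp {_}.
Arguments zero {_}.

Definition one {A : inq_structure} : A := imp zero zero.

Inductive core_closure (A : inq_structure) : set A :=
| closure_core x : core A x -> core_closure x
| closure_zero : core_closure zero
| closure_meet x y :
    core_closure x -> core_closure y -> core_closure (meet x y)
| closure_join x y :
    core_closure x -> core_closure y -> core_closure (join x y)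
| closure_imp x y :
    core_closure x -> core_closure y -> core_closure (imp x y).

Arguments core_closure : clear implicits.

Definition inquisitive_algebra (A : inq_structure) : Prop :=
  [/\ heyting_algebra_on (core_closure A) join meet imp zero,
      brouwerian_semilattice_on (core A) meet imp zero
    & forall a x y, core A a -> core_closure A x -> core_closure A y ->
        imp a (join x y) = join (imp a x) (imp a y)].

Definition core_generated (A : inq_structure) : Prop :=
  core_closure A = [set: A].

Definition well_connected (A : inq_structure) : Prop :=
  forall x y, core_closure A x -> core_closure A y ->
    join x y = one -> x = one \/ y = one.

Fixpoint eval (At : Type) (A : inq_structure) (mu : At -> A) (phi : form At) :
    A :=
  match phi with
  | Var p => mu p
  | Bot => zero
  | And phi1 phi2 => meet (eval mu phi1) (eval mu phi2)
  | Or phi1 phi2 => join (eval mu phi1) (eval mu phi2)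
  | Imp phi1 phi2 => imp (eval mu phi1) (eval mu phi2)
  end.

Definition core_valuation (At : Type) (A : inq_structure) (mu : At -> A) :
    Prop :=
  forall p, core A (mu p).

Definition core_valid (At : Type) (A : inq_structure) (phi : form At) : Prop :=
  forall mu : At -> A, core_valuation mu -> eval mu phi = one.

Definition inq_algebra_for (At : Type) (Lambda : set (form At))
    (A : inq_structure) : Prop :=
  inquisitive_algebra A /\ (forall psi, Lambda psi -> core_valid A psi).

(* Main.v *)
From mathcomp Require Import all_boot.
From mathcomp Require Import boolp classical_sets cardinality.
Require Import Defs.

Set Implicit Arguments.
Unset Strict Implicit.
Unset Printing Implicit Defensive.

Local Open Scope classical_set_scope.

(** A refuting core valuation of [phi] uses finitely many core elements, and by
    Diego's theorem they generate a finite Brouwerian subsemilattice [C] of the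
    core; standard formulas valid on the core remain valid on [C].  The downsets
    of [C] containing [0], with the principal ones as core, form a finite
    well-connected inquisitive algebra [B].  By the split law, [eval phi] in the
    given algebra is the join of core elements generating the downset [eval phi]
    in [B], so [phi] cannot be valid in [B].

    For Diego's theorem, write [~x] for [x ⇒ p] with [p] a generator.  Every
    element is a meet of elements [x ⇒ p = ~~~x], and [~~(x ⇒ y)] is the meet of
    [~~x ⇒ ~~y] and [~~(p ⇒ x ⇒ y)].  In the latter, [x ⇒ y] may be evaluated
    with [p] replaced by the top, where one generator fewer is involved.  So, by
    induction, all [~~x] lie in a finitely generated Boolean algebra. *)

(** * Order and residuation in a Brouwerian semilattice *)

Section BrouwerianSemilattice.

Variables (T : choiceType) (m i : T -> T -> T) (z : T).
Hypothesis bsl : brouwerian_semilattice_on [set: T] m i z.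

Local Infix "⊓" := m (at level 40, left associativity).
Local Infix "⇒" := i (at level 45, right associativity).
Local Notation "x ≼ y" := (meet_le m x y) (at level 70).
Local Notation top := (i z z).

Lemma bsl_meetxx x : x ⊓ x = x.
Proof. by have [[_ + _ _] _ _ _ _] := bsl; apply. Qed.

Lemma bsl_meetC x y : x ⊓ y = y ⊓ x.
Proof. by have [[_ _ + _] _ _ _ _] := bsl; apply. Qed.

Lemma bsl_meetA x y w : x ⊓ (y ⊓ w) = x ⊓ y ⊓ w.
Proof. by have [[_ _ _ +] _ _ _ _] := bsl; apply. Qed.

Lemma bsl_le_refl x : x ≼ x.
Proof. exact: bsl_meetxx. Qed.

Lemma bsl_le_trans y x w : x ≼ y -> y ≼ w -> x ≼ w.
Proof. by rewrite /meet_le => xy yw; rewrite -xy -bsl_meetA yw. Qed.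

Lemma bsl_le_meet w x y : w ≼ x ⊓ y <-> w ≼ x /\ w ≼ y.
Proof.
rewrite /meet_le; split=> [<-|[wx wy]]; last by rewrite bsl_meetA wx.
split; last by rewrite -!bsl_meetA bsl_meetxx.
by rewrite -bsl_meetA (bsl_meetC (x ⊓ y)) (bsl_meetA x) bsl_meetxx.
Qed.

(* Residuation in the form of the Kripke forcing clause for implication: with
   [bsl_le_meet] and [bsl_eqP] it turns identities of the semilattice into
   intuitionistic reasoning about the elements below a given one. *)
Lemma bsl_le_imp w x y :
  w ≼ x ⇒ y <-> forall v, v ≼ w -> v ≼ x -> v ≼ y.
Proof.
have [_ _ _ _ res] := bsl.
split=> [wxy v vw vx|h]; last first.
  by apply/(res w x y) => //; have /bsl_le_meet[??] := bsl_le_refl (w ⊓ x); apply: h.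
by apply: (@bsl_le_trans (w ⊓ x)); [exact/bsl_le_meet|apply/(res w x y)].
Qed.

Lemma bsl_eqP x y : (forall w, w ≼ x <-> w ≼ y) -> x = y.
Proof.
move=> h; have /h xy := bsl_le_refl x; have /h yx := bsl_le_refl y.
by rewrite -xy bsl_meetC yx.
Qed.

Lemma bsl_le_top x : x ≼ top.
Proof. exact/bsl_le_imp. Qed.

Lemma bsl_le_app w x y : w ≼ x ⇒ y -> w ≼ x -> w ≼ y.
Proof. by move=> /bsl_le_imp h wx; apply: h => //; apply: bsl_le_refl. Qed.

Lemma bsl_impD x y w : x ⇒ y ⊓ w = (x ⇒ y) ⊓ (x ⇒ w).
Proof.
apply: bsl_eqP => u; rewrite bsl_le_meet !bsl_le_imp; split=> [h|[h h'] v vu vx].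
  by split=> v vu vx; have /bsl_le_meet[] := h v vu vx.
by apply/bsl_le_meet; split; [apply: h|apply: h'].
Qed.

Lemma bsl_curry x y w : x ⇒ y ⇒ w = x ⊓ y ⇒ w.
Proof.
apply: bsl_eqP => u; rewrite !bsl_le_imp; split=> [h v vu /bsl_le_meet[vx vy]|].
  exact: bsl_le_app (h _ vu vx) vy.
move=> h v vu vx; apply/bsl_le_imp => t tv ty.
by apply: h; [apply: bsl_le_trans tv vu|apply/bsl_le_meet; split=> //;
  apply: bsl_le_trans tv vx].
Qed.

Lemma bsl_impxT x : x ⇒ top = top.
Proof.
apply: bsl_eqP => u; split=> _; first exact: bsl_le_top.
by apply/bsl_le_imp => *; apply: bsl_le_top.
Qed.

Lemma bsl_impTx x : top ⇒ x = x.
Proof.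
apply: bsl_eqP => u; split=> [h|ux]; first exact: bsl_le_app h (bsl_le_top u).
by apply/bsl_le_imp => v vu _; apply: bsl_le_trans vu ux.
Qed.

Lemma bsl_impxx x : x ⇒ x = top.
Proof.
by apply: bsl_eqP => u; split=> _; [exact: bsl_le_top|apply/bsl_le_imp].
Qed.

Lemma bsl_meetxT x : x ⊓ top = x.
Proof. exact: bsl_le_top. Qed.

(** The least element is not built in and must be supplied as a generator, so that the induction for
    Diego's theorem treats it like any other. The top is built in because it replaces discarded
    generators. *)
Inductive generated (G : set T) : set T :=
| generated_gen x : G x -> generated G x
| generated_top : generated G top
| generated_meet x y : generated G x -> generated G y -> generated G (x ⊓ y)
| generated_imp x y : generated G x -> generated G y -> generated G (x ⇒ y).

(** * Negation and double negation relative to an element [p] *)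

Section RelativeNegation.

Variable p : T.
Local Notation "~~~ x" := (x ⇒ p) (at level 35).
Local Notation jj x := (~~~ (~~~ x)).

Lemma bsl_le_neg2 w x : w ≼ x -> w ≼ jj x.
Proof.
move=> wx; apply/bsl_le_imp => v vw nv; apply: bsl_le_app nv _.
exact: bsl_le_trans vw wx.
Qed.

Lemma bsl_neg3 x : ~~~ (jj x) = ~~~ x.
Proof.
apply: bsl_eqP => w; split; last exact: bsl_le_neg2.
move=> h; apply/bsl_le_imp => v vw vx; apply: bsl_le_app (bsl_le_neg2 vx).
exact: bsl_le_trans vw h.
Qed.

Lemma bsl_neg2_meet x y : jj (x ⊓ y) = jj x ⊓ jj y.
Proof.
apply: bsl_eqP => w; rewrite bsl_le_meet; split.
  move=> h; split; apply/bsl_le_imp => v vw nv;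
    apply: (bsl_le_app (bsl_le_trans vw h));
    apply/bsl_le_imp => u uv /bsl_le_meet[ux uy];
    exact: bsl_le_app (bsl_le_trans uv nv) _.
move=> [hx hy]; apply/bsl_le_imp => v vw nv.
apply: (bsl_le_app (bsl_le_trans vw hx)).
apply/bsl_le_imp => u uv ux; apply: (bsl_le_app (bsl_le_trans (bsl_le_trans uv vw) hy)).
apply/bsl_le_imp => t tu ty; apply: (bsl_le_app (bsl_le_trans (bsl_le_trans tu uv) nv)).
by apply/bsl_le_meet; split=> //; apply: bsl_le_trans tu ux.
Qed.

(* A maximal point refuting [p] satisfies [x ⇒ y] iff it satisfies it locally,
   as a classical implication, and [x ⇒ y] holds at all points where [p]
   does. *)
Lemma bsl_neg2_imp x y : jj (x ⇒ y) = jj (p ⇒ x ⇒ y) ⊓ (jj x ⇒ jj y).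
Proof.
apply: bsl_eqP => w; rewrite bsl_le_meet; split.
  move=> h; split.
    apply/bsl_le_imp => v vw nv; apply: (bsl_le_app (bsl_le_trans vw h)).
    apply/bsl_le_imp => u uv uxy; apply: (bsl_le_app (bsl_le_trans uv nv)).
    by apply/bsl_le_imp => t tu _; apply: bsl_le_trans tu uxy.
  apply/bsl_le_imp => v vw vx.
  have: v ≼ jj (x ⊓ (x ⇒ y)).
    by rewrite bsl_neg2_meet; apply/bsl_le_meet; split=> //; apply: bsl_le_trans vw h.
  move=> {}h; apply/bsl_le_imp => u uv ny; apply: (bsl_le_app (bsl_le_trans uv h)).
  apply/bsl_le_imp => t tu /bsl_le_meet[tx txy].
  by apply: (bsl_le_app (bsl_le_trans tu ny)); apply: bsl_le_app txy tx.
move=> [ha hb]; apply/bsl_le_imp => v vw nv.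
apply: (bsl_le_app (bsl_le_trans vw ha)).
apply/bsl_le_imp => u uv ua.
apply: (bsl_le_app (bsl_le_trans uv nv)).
apply/bsl_le_imp => t tu tx.
(* Below [x], [hb] gives [jj y]; but [y] implies [x ⇒ y], which [nv] sends to [p]. So [p] holds at
   [t], and [ua] becomes applicable. *)
have tp : t ≼ p.
  have tv := bsl_le_trans tu uv.
  apply: (@bsl_le_app _ (~~~ y)).
    by apply: (bsl_le_app (bsl_le_trans (bsl_le_trans tv vw) hb)); apply: bsl_le_neg2.
  apply/bsl_le_imp => s st sy; apply: (bsl_le_app (bsl_le_trans (bsl_le_trans st tv) nv)).
  by apply/bsl_le_imp => r rs _; apply: bsl_le_trans rs sy.
exact: bsl_le_app (bsl_le_app (bsl_le_trans tu ua) tp) tx.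
Qed.

Definition bsl_regular : set T := [set x | jj x = x].

Lemma bsl_regular_bot x : bsl_regular x -> p ≼ x.
Proof.
by move=> <-; apply/bsl_le_imp => v vp _.
Qed.

Lemma generated_regular (K : set T) :
  K `<=` bsl_regular -> generated K `<=` bsl_regular.
Proof.
move=> Kreg x; elim=> {x} [x /Kreg//||x y _ xr _ yr|x y _ xr _ yr].
- by rewrite /bsl_regular /= bsl_impTx bsl_impxx.
- by rewrite /bsl_regular /= bsl_neg2_meet xr yr.
(* With [jj y] for [y], currying turns [x ⇒ y] into a relative negation, and negations are
   regular. *)
- rewrite /bsl_regular/= -yr.
  by rewrite bsl_curry bsl_neg3.
Qed.

(** Classical case distinction on [k], valid because regularity lets [x] be proved by refuting
    [~~~ x]: under [~~~ x], the first factor gives [~~~ k], then the second gives [x]. *)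
Lemma bsl_regular_split k x : bsl_regular x -> x = (k ⇒ x) ⊓ (~~~ k ⇒ x).
Proof.
move=> xr; apply: bsl_eqP => w; rewrite bsl_le_meet; split=> [wx|[h1 h0]].
  by split; apply/bsl_le_imp => v vw _; apply: bsl_le_trans vw wx.
rewrite -xr; apply/bsl_le_imp => v vw nv.
apply: (bsl_le_app nv); apply: (bsl_le_app (bsl_le_trans vw h0)).
apply/bsl_le_imp => u uv uk; apply: (bsl_le_app (bsl_le_trans uv nv)).
exact: (bsl_le_app (bsl_le_trans (bsl_le_trans uv vw) h1)).
Qed.

(** Under [k], the assumption [~~~ k] yields [p], which lies below every regular element, so the
    second component holds for free; symmetrically under [~~~ k]. Hence implication is computed
    componentwise. *)
Lemma bsl_shannon_imp k x1 x0 y1 y0 :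
  bsl_regular x1 -> bsl_regular x0 -> bsl_regular y1 -> bsl_regular y0 ->
  (k ⇒ x1) ⊓ (~~~ k ⇒ x0) ⇒ (k ⇒ y1) ⊓ (~~~ k ⇒ y0) =
  (k ⇒ x1 ⇒ y1) ⊓ (~~~ k ⇒ x0 ⇒ y0).
Proof.
do 4!move=> /bsl_regular_bot ?.
apply: bsl_eqP => w; rewrite bsl_le_meet; split=> [h|[h1 h0]]; last first.
  apply/bsl_le_imp => v vw /bsl_le_meet[v1 v0]; apply/bsl_le_meet; split;
    apply/bsl_le_imp => u uv uk; have uw := bsl_le_trans uv vw.
    by apply: (bsl_le_app (bsl_le_app (bsl_le_trans uw h1) uk));
      apply: (bsl_le_app (bsl_le_trans uv v1)).
  by apply: (bsl_le_app (bsl_le_app (bsl_le_trans uw h0) uk));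
    apply: (bsl_le_app (bsl_le_trans uv v0)).
split; apply/bsl_le_imp => v vw vk; apply/bsl_le_imp => u uv ux;
  have uk := bsl_le_trans uv vk.
- have /bsl_le_meet[] : u ≼ (k ⇒ y1) ⊓ (~~~ k ⇒ y0).
    apply: (bsl_le_app (bsl_le_trans (bsl_le_trans uv vw) h)).
    apply/bsl_le_meet; split; apply/bsl_le_imp => t tu tk.
      exact: bsl_le_trans tu ux.
    by apply: (@bsl_le_trans p) => //; apply: bsl_le_app tk (bsl_le_trans tu uk).
  by move=> h1 _; apply: bsl_le_app h1 uk.
- have /bsl_le_meet[] : u ≼ (k ⇒ y1) ⊓ (~~~ k ⇒ y0).
    apply: (bsl_le_app (bsl_le_trans (bsl_le_trans uv vw) h)).
    apply/bsl_le_meet; split; apply/bsl_le_imp => t tu tk; last first.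
      exact: bsl_le_trans tu ux.
    by apply: (@bsl_le_trans p) => //; apply: bsl_le_app (bsl_le_trans tu uk) tk.
  by move=> _ h0; apply: bsl_le_app h0 uk.
Qed.

Lemma bsl_regularp : bsl_regular p.
Proof. by rewrite /bsl_regular /= bsl_impxx bsl_impTx. Qed.

(* Regular elements form a Boolean algebra with least element [p], so the
   generated elements are enumerated by Shannon expansion along the
   generators. *)
Lemma finite_generated_regular (K : set T) :
  finite_set K -> K `<=` bsl_regular -> finite_set (generated (p |` K)).
Proof.
move=> /finite_seqP[s ->]; elim: s => [_|k s IH ks].
  apply: (@sub_finite_set _ _ [set p; top]) => [x|]; last exact: finite_set2.
  elim=> {x} [x [->|//]||x y _ [->|->] _ [->|->]|x y _ [->|->] _ [->|->]];
    rewrite ?bsl_meetxx ?bsl_meetxT ?(bsl_meetC top) ?bsl_meetxT ?bsl_impxx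
      ?bsl_impTx ?bsl_impxT; by [left|right].
have sreg : [set` s] `<=` bsl_regular.
  by move=> x xs; apply: ks; rewrite /= inE (_ : x \in s) ?orbT.
have kreg : bsl_regular k by apply: ks; rewrite /= inE eqxx.
have greg : generated (p |` [set` s]) `<=` bsl_regular.
  by apply: generated_regular => x [->|/sreg//]; apply: bsl_regularp.
pose D := generated (p |` [set` s]).
apply: (@sub_finite_set _ _
    [set (k ⇒ xy.1) ⊓ (~~~ k ⇒ xy.2) | xy in D `*` D]); last first.
  by apply: finite_image; apply: finite_setX; apply: IH.
have inD x : D x -> [set (k ⇒ xy.1) ⊓ (~~~ k ⇒ xy.2) | xy in D `*` D] x.
  by move=> Dx; exists (x, x) => //=; rewrite -bsl_regular_split //; apply: greg.
move=> x; elim=> {x} [x [->|]||x y _ [[x1 x0] /= [Dx1 Dx0] <-]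
    _ [[y1 y0] /= [Dy1 Dy0] <-]|x y _ [[x1 x0] /= [Dx1 Dx0] <-]
    _ [[y1 y0] /= [Dy1 Dy0] <-]].
- by apply: inD; apply: generated_gen; left.
- rewrite /= inE => /orP[/eqP->|xs]; last by apply: inD; apply: generated_gen; right.
  (* The expansion of [k] itself has components true and false; it reduces to [~~~ k ⇒ p], which is
     [k] by regularity. *)
  exists (top, p) => /=; last by rewrite bsl_impxT bsl_meetC bsl_meetxT kreg.
  by split; [apply: generated_top|apply: generated_gen; left].
- by apply: inD; apply: generated_top.
- exists (x1 ⊓ y1, x0 ⊓ y0); first by split; apply: generated_meet.
  rewrite /= !bsl_impD -!bsl_meetA; congr (_ ⊓ _).
  by rewrite bsl_meetA (bsl_meetC _ (~~~ k ⇒ x0)) -bsl_meetA.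
- exists (x1 ⇒ y1, x0 ⇒ y0); first by split; apply: generated_imp.
  by rewrite bsl_shannon_imp //; apply: greg.
Qed.

End RelativeNegation.

(** * Finiteness of finitely generated Brouwerian semilattices *)

Lemma bsl_imp_relativize p x x' : p ⊓ x = p ⊓ x' -> p ⇒ x = p ⇒ x'.
Proof.
have aux y : p ⇒ y = p ⇒ p ⊓ y.
  apply: bsl_eqP => w; rewrite bsl_impD bsl_impxx bsl_meetC.
  by rewrite bsl_meetxT.
by move=> e; rewrite aux e -aux.
Qed.

(* [y] is the value of [x] when the generator [p] is replaced by the top. *)
Lemma generated_relativize (G : set T) p x : generated G x ->
  exists2 y, generated (G `\ p) y & p ⊓ x = p ⊓ y.
Proof.
elim=> {x} [x Gx||x1 x2 _ [y1 g1 e1] _ [y2 g2 e2]|x1 x2 _ [y1 g1 e1] _ [y2 g2 e2]].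
- have [->|/eqP xp] := eqVneq x p.
    by exists top; [apply: generated_top|rewrite bsl_meetxx bsl_meetxT].
  by exists x => //; apply: generated_gen.
- by exists top => //; apply: generated_top.
- exists (y1 ⊓ y2); first exact: generated_meet.
  by rewrite bsl_meetA e1 -bsl_meetA (bsl_meetC y1) bsl_meetA e2 -bsl_meetA
    (bsl_meetC y2).
- exists (y1 ⇒ y2); first exact: generated_imp.
  (* Below [p] an implication depends only on the parts of its arguments below [p]. *)
  have aux a b : p ⊓ (a ⇒ b) = p ⊓ (p ⊓ a ⇒ p ⊓ b).
    apply: bsl_eqP => w; rewrite !bsl_le_meet; split=> -[wp h]; split=> //;
      apply/bsl_le_imp => v vw; have vp := bsl_le_trans vw wp.
      move=> /bsl_le_meet[_ va]; apply/bsl_le_meet; split=> //.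
      exact: (bsl_le_app (bsl_le_trans vw h)).
    move=> va; suff /bsl_le_meet[] : v ≼ p ⊓ b by [].
    by apply: (bsl_le_app (bsl_le_trans vw h)); apply/bsl_le_meet.
  by rewrite aux e1 e2 -aux.
Qed.

(** By triple negation [x ⇒ p] is determined by [j x], so it suffices to confine all [j x] to one
    finite Boolean algebra. Its generators [K] are what remains when [j] is pushed through meets and
    implications. *)
Lemma finite_generated_neg (G : set T) p : finite_set G ->
  finite_set (generated (G `\ p)) -> finite_set [set x ⇒ p | x in generated G].
Proof.
move=> finG finG'; pose j x := (x ⇒ p) ⇒ p.
pose K := (j @` G) `|` [set j (p ⇒ x) | x in generated (G `\ p)].
have Kreg : K `<=` bsl_regular p.
  by move=> _ [[x _ <-]|[x _ <-]]; rewrite /bsl_regular /= bsl_neg3.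
have finK : finite_set (generated (p |` K)).
  apply: finite_generated_regular => //.
  by rewrite finite_setU; split; apply: finite_image.
suff jK x : generated G x -> generated (p |` K) (j x).
  apply: sub_finite_set (finite_image (fun x => x ⇒ p) finK) => _ [x Gx <-].
  by exists (j x); [apply: jK|rewrite bsl_neg3].
elim=> {x} [x Gx||x y _ gx _ gy|x y Gx gx Gy gy].
- by apply: generated_gen; right; left; exists x.
- by rewrite /j bsl_impTx bsl_impxx; apply: generated_top.
- by rewrite /j bsl_neg2_meet; apply: generated_meet.
- rewrite /j bsl_neg2_imp; apply: generated_meet; last exact: generated_imp.
  have [t tG e] := generated_relativize p (generated_imp Gx Gy).
  by rewrite (bsl_imp_relativize e); apply: generated_gen; right; right; exists t.
Qed.

Inductive meet_closure (E : set T) : set T :=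
| meet_closure_in x : E x -> meet_closure E x
| meet_closure_top : meet_closure E top
| meet_closure_meet x y :
    meet_closure E x -> meet_closure E y -> meet_closure E (x ⊓ y).

(** By idempotence, a further generator [e] at most doubles the closure: each meet contains [e] once
    or not at all. *)
Lemma finite_meet_closure (E : set T) :
  finite_set E -> finite_set (meet_closure E).
Proof.
move=> /finite_seqP[s ->]; elim: s => [|e s IH].
  apply: (@sub_finite_set _ _ [set top]) (finite_set1 _) => x.
  by elim=> {x} [//|//|x y _ -> _ ->]; apply: bsl_meetxx.
pose D := meet_closure [set` s].
apply: (@sub_finite_set _ _ (D `|` (fun x => e ⊓ x) @` D)); last first.
  by rewrite finite_setU; split=> //; apply: finite_image.
move=> x; elim=> {x} [x||x y _ hx _ hy].
- rewrite /= inE => /orP[/eqP->|xs]; last by left; apply: meet_closure_in.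
  by right; exists top; [apply: meet_closure_top|apply: bsl_meetxT].
- by left; apply: meet_closure_top.
- case: hx hy => [Dx|[x' Dx <-]] [Dy|[y' Dy <-]].
  + by left; apply: meet_closure_meet.
  + right; exists (x ⊓ y'); first exact: meet_closure_meet.
    by rewrite !bsl_meetA (bsl_meetC e).
  + right; exists (x' ⊓ y); first exact: meet_closure_meet.
    by rewrite !bsl_meetA.
  + right; exists (x' ⊓ y'); first exact: meet_closure_meet.
    by rewrite !bsl_meetA (bsl_meetC (e ⊓ x') e) !bsl_meetA bsl_meetxx.
Qed.

(** Implication distributes over meets on its right, and currying merges [x ⇒ u ⇒ p] into
    [x ⊓ u ⇒ p], so every generated element is a meet of implications ending in a generator. *)
Lemma generated_meet_closure (G : set T) : generated G `<=`
  meet_closure (\bigcup_(p in G) [set x ⇒ p | x in generated G]).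
Proof.
move=> x; elim=> {x} [x Gx||x y _ + _ +|x y Gx _ _].
- apply: meet_closure_in; exists x => //.
  by exists top; [apply: generated_top|apply: bsl_impTx].
- exact: meet_closure_top.
- exact: meet_closure_meet.
- elim=> {y} [_ [p Gp [u Gu <-]]||u v _ hu _ hv].
  + apply: meet_closure_in; exists p => //.
    by exists (x ⊓ u); [apply: generated_meet|rewrite bsl_curry].
  + by rewrite bsl_impxT; apply: meet_closure_top.
  + by rewrite bsl_impD; apply: meet_closure_meet.
Qed.

(** Diego's theorem. *)
Lemma finite_generated (G : set T) : finite_set G -> finite_set (generated G).
Proof.
move=> /finite_seqP[s ->]; have [n] := ubnP (size s).
elim: n s => // n IH s; rewrite ltnS => sn.
apply: sub_finite_set (@generated_meet_closure _) _.
apply: finite_meet_closure; apply: bigcup_finite => [|p /= ps].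
  by apply/finite_seqP; exists s.
apply: finite_generated_neg; first by apply/finite_seqP; exists s.
(* Since [p] occurs in [s], filtering it out strictly shortens the list. *)
have -> : [set` s] `\ p = [set` filter (predC1 p) s].
  apply/seteqP; split=> x /=; rewrite mem_filter /=.
    by move=> [xs /eqP xp]; rewrite xp.
  by move=> /andP[/eqP].
apply: IH; apply: leq_trans sn; rewrite size_filter.
by rewrite -(count_predC (pred1 p)) -[X in (X < _)%N]add0n ltn_add2r -has_count has_pred1.
Qed.

End BrouwerianSemilattice.

(** An injective morphism reflects equations, and the order is an equation. This turns the core, and
    later a finite part of it, into a structure on a whole type. *)
Lemma brouwerian_semilattice_pullback (T U : Type) (f : U -> T) (S : set T)
    (m i : T -> T -> T) (z : T) (m' i' : U -> U -> U) (z' : U) :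
  injective f -> (forall u, S (f u)) ->
  {morph f : x y / m' x y >-> m x y} -> {morph f : x y / i' x y >-> i x y} ->
  f z' = z ->
  brouwerian_semilattice_on S m i z ->
  brouwerian_semilattice_on [set: U] m' i' z'.
Proof.
move=> f_inj Sf fm fi fz [[_ mxx mC mA] _ _ z_le res].
have leE x y : meet_le m' x y <-> meet_le m (f x) (f y).
  by rewrite /meet_le -fm; split=> [->//|/f_inj].
split=> //.
- split=> // [x _|x y _ _|x y w _ _ _]; apply: f_inj; rewrite !fm; auto.
- by move=> x _; apply/leE; rewrite fz; apply: z_le.
- by move=> a b c _ _ _; rewrite !leE fm fi; apply: res.
Qed.

(** * Heyting algebras on a subset of a type *)

Section HeytingOn.

Variables (T : Type) (S : set T) (j m i : T -> T -> T) (z : T).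
Hypothesis hey : heyting_algebra_on S j m i z.

Local Notation "x ≼ y" := (meet_le m x y) (at level 70).

Lemma hey_meetC x y : S x -> S y -> m x y = m y x.
Proof. by have [[[_ _ + _] _ _ _] _ _ _ _] := hey; apply. Qed.

Lemma hey_le_refl x : S x -> x ≼ x.
Proof. by have [[[_ + _ _] _ _ _] _ _ _ _] := hey; apply. Qed.

Lemma hey_le_trans y x w : S x -> S y -> S w -> x ≼ y -> y ≼ w -> x ≼ w.
Proof.
have [[[_ _ _ mA] _ _ _] _ _ _ _] := hey.
by rewrite /meet_le => Sx Sy Sw xy yw; rewrite -xy -mA // yw.
Qed.

Lemma hey_le_antisym x y : S x -> S y -> x ≼ y -> y ≼ x -> x = y.
Proof. by move=> Sx Sy xy yx; rewrite -xy hey_meetC. Qed.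

Lemma hey_le_joinE x y : S x -> S y -> x ≼ y <-> j x y = y.
Proof.
have [[_ [_ _ jC _] mjK jmK] _ _ _ _] := hey; have [[[mS _ _ _] _ _ _] _ _ _ _] := hey.
move=> Sx Sy; split=> [xy|<-]; last exact: mjK.
by rewrite -xy hey_meetC // jC ?jmK //; apply: mS.
Qed.

Lemma hey_join_le x y w : S x -> S y -> S w ->
  j x y ≼ w <-> x ≼ w /\ y ≼ w.
Proof.
have [[_ [jS _ jC jA] mjK _] _ _ _ _] := hey.
move=> Sx Sy Sw; split=> [h|[/hey_le_joinE xw /hey_le_joinE yw]]; last first.
  by apply/hey_le_joinE; rewrite -?jA ?yw ?xw //; apply: jS.
split; apply: hey_le_trans h => //; try exact: jS; first exact: mjK.
by rewrite jC //; apply: mjK.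
Qed.

Lemma hey_le_meet x y w : S x -> S y -> S w ->
  w ≼ m x y <-> w ≼ x /\ w ≼ y.
Proof.
have [[[mS mxx mC mA] _ _ _] _ _ _ _] := hey.
rewrite /meet_le => Sx Sy Sw; have Sxy := mS _ _ Sx Sy.
split=> [<-|[wx wy]]; last by rewrite mA ?wx.
split; first by rewrite -mA // (mC _ x) // (mA x) // mxx.
by rewrite -mA // -(mA x) // mxx.
Qed.

Lemma hey_le_imp x y w : S x -> S y -> S w -> m x y ≼ w <-> x ≼ i y w.
Proof. by have [_ _ _ _] := hey; apply. Qed.

(** By residuation both sides have the same upper bounds in [S]. *)
Lemma hey_meet_joinl x y w : S x -> S y -> S w ->
  m (j x y) w = j (m x w) (m y w).
Proof.
have [[[mS _ _ _] [jS _ _ _] _ _] iS _ _ _] := hey => Sx Sy Sw.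
have Sl : S (m (j x y) w) by apply: mS => //; apply: jS.
have Sr : S (j (m x w) (m y w)) by apply: jS; apply: mS.
have yoneda t : S t -> m (j x y) w ≼ t <-> j (m x w) (m y w) ≼ t.
  move=> St; rewrite hey_le_imp ?hey_join_le ?hey_le_imp //; auto.
by apply: hey_le_antisym => //; apply/yoneda => //; apply: hey_le_refl.
Qed.

Lemma hey_imp_joinl x y w : S x -> S y -> S w ->
  i (j x y) w = m (i x w) (i y w).
Proof.
have [[[mS _ _ _] [jS _ _ _] _ _] iS _ _ _] := hey => Sx Sy Sw.
have Sl : S (i (j x y) w) by apply: iS => //; apply: jS.
have Sr : S (m (i x w) (i y w)) by apply: mS; apply: iS.
(* The map sending [a] to [i a w] is Galois-adjoint to itself, hence turns joins into meets. *)
have swap a t : S a -> S t -> t ≼ i a w <-> a ≼ i t w.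
  by move=> Sa St; rewrite -!hey_le_imp // hey_meetC.
have yoneda t : S t -> t ≼ i (j x y) w <-> t ≼ m (i x w) (i y w).
  by move=> St; rewrite swap ?hey_join_le ?hey_le_meet ?(swap _ t) //; auto.
by apply: hey_le_antisym => //; apply/yoneda => //; apply: hey_le_refl.
Qed.

End HeytingOn.

(** * The inquisitive algebra of downsets of a finite Brouwerian semilattice *)

Section DownsetStructure.

Variables (C : finType) (m i : C -> C -> C) (z : C).
Hypothesis bsl : brouwerian_semilattice_on [set: C] m i z.

Local Notation "x ≼ y" := (meet_le m x y) (at level 70).
Local Notation top := (i z z).

(** Requiring [z] excludes the empty downset, so that the least element is the principal downset of
    [z] and lies in the core. *)
Definition is_downset (U : {set C}) : bool :=
  (z \in U) && [forall y in U, forall x, (m x y == x) ==> (x \in U)].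

Local Notation downset := {U : {set C} | is_downset U}.

Lemma is_downsetP (U : {set C}) :
  reflect (z \in U /\ forall x y, x ≼ y -> y \in U -> x \in U) (is_downset U).
Proof.
apply: (iffP andP) => -[zU h]; split=> //.
  move=> x y /eqP xy yU; move/forall_inP: h => /(_ _ yU) /forallP /(_ x).
  by rewrite xy.
by apply/forall_inP => y yU; apply/forallP => x; apply/implyP => /eqP xy; apply: h yU.
Qed.

Lemma downset_zero (U : downset) : z \in val U.
Proof. by case/is_downsetP: (valP U). Qed.

Lemma downset_le (U : downset) x y : x ≼ y -> y \in val U -> x \in val U.
Proof. by case/is_downsetP: (valP U) => _; apply. Qed.

Lemma bsl_zero_le x : z ≼ x.
Proof. by have [_ _ _ + _] := bsl; apply. Qed.

Lemma is_downset_principal c : is_downset [set x | m x c == x].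
Proof.
apply/is_downsetP; split; first by rewrite inE; apply/eqP; apply: bsl_zero_le.
by move=> x y xy; rewrite !inE => /eqP yc; apply/eqP; exact: (bsl_le_trans bsl xy yc).
Qed.

Lemma is_downsetI (U V : downset) : is_downset (val U :&: val V).
Proof.
apply/is_downsetP; rewrite inE !downset_zero; split=> // x y xy.
by rewrite !inE => /andP[yU yV]; rewrite !(downset_le xy).
Qed.

Lemma is_downsetU (U V : downset) : is_downset (val U :|: val V).
Proof.
apply/is_downsetP; rewrite inE !downset_zero; split=> // x y xy.
by rewrite !inE => /orP[] /(downset_le xy) ->; rewrite ?orbT.
Qed.

(** The Kripke clause for implication, with smaller elements of [C] as the later points. *)
Definition imp_set (U V : downset) : {set C} :=
  [set x | [forall y in val U, (m y x == y) ==> (y \in val V)]].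

Lemma imp_setP (U V : downset) x : reflect
  (forall y, y ≼ x -> y \in val U -> y \in val V) (x \in imp_set U V).
Proof.
rewrite inE; apply: (iffP forall_inP) => h y; last first.
  by move=> yU; apply/implyP => /eqP yx; apply: h.
by move=> yx yU; move: (h y yU); rewrite yx eqxx.
Qed.

Lemma is_downset_imp (U V : downset) : is_downset (imp_set U V).
Proof.
apply/is_downsetP; split=> [|x y xy /imp_setP h]; apply/imp_setP => w wx.
  by move=> _; apply: downset_le wx (downset_zero V).
by apply: h; exact: (bsl_le_trans bsl wx xy).
Qed.

Definition principal (c : C) : downset := Sub _ (is_downset_principal c).

Definition downset_structure : inq_structure :=
  @InqStructure downset (range principal)
    (fun U V => Sub _ (is_downsetI U V)) (fun U V => Sub _ (is_downsetU U V))
    (fun U V => Sub _ (is_downset_imp U V)) (principal z).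

Local Notation B := downset_structure.

Definition in_downset (x : C) (U : B) : Prop := x \in val (U : downset).
Local Notation "x ⊩ U" := (in_downset x U) (at level 70).

Lemma in_meet x (U V : B) : x ⊩ meet U V <-> x ⊩ U /\ x ⊩ V.
Proof. by rewrite /in_downset /= inE; split=> /andP. Qed.

Lemma in_join x (U V : B) : x ⊩ join U V <-> x ⊩ U \/ x ⊩ V.
Proof. by rewrite /in_downset /= inE; split=> /orP. Qed.

Lemma in_imp x (U V : B) :
  x ⊩ imp U V <-> forall y, y ≼ x -> y ⊩ U -> y ⊩ V.
Proof. by split=> /imp_setP. Qed.

Lemma in_principal x c : x ⊩ principal c <-> x ≼ c.
Proof. by rewrite /in_downset /= inE; split=> /eqP. Qed.

Lemma in_down x y (U : B) : x ≼ y -> y ⊩ U -> x ⊩ U.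
Proof. exact: downset_le. Qed.

Lemma in_zero x : x ⊩ zero <-> x = z.
Proof.
rewrite in_principal; split=> [xz|->]; last exact: bsl_le_refl bsl z.
by rewrite -(bsl_zero_le x) (bsl_meetC bsl) xz.
Qed.

Lemma downset_eqP (U V : B) : (forall x, x ⊩ U <-> x ⊩ V) -> U = V.
Proof. by move=> h; apply/val_inj/setP => x; apply/idP/idP => /h. Qed.

Lemma downset_leP (U V : B) :
  meet_le meet U V <-> forall x, x ⊩ U -> x ⊩ V.
Proof.
split=> [<- x /in_meet[]//|h]; apply: downset_eqP => x; rewrite in_meet.
by split=> [[]//|xU]; split=> //; apply: h.
Qed.

Lemma principal_inj : injective principal.
Proof.
move=> c d e; apply: (bsl_eqP bsl) => x.
by rewrite -!in_principal e.
Qed.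

Lemma principal_meet c d : principal (m c d) = @meet B (principal c) (principal d).
Proof.
by apply: downset_eqP => x; rewrite in_meet !in_principal (bsl_le_meet bsl).
Qed.

Lemma principal_imp c d : principal (i c d) = @imp B (principal c) (principal d).
Proof.
apply: downset_eqP => x; rewrite in_imp in_principal (bsl_le_imp bsl).
by split=> h y yx; move: (h y yx); rewrite !in_principal.
Qed.

Lemma principal_top : principal top = @one B.
Proof. exact: principal_imp. Qed.

Lemma downset_core_generated : core_generated B.
Proof.
apply/seteqP; split=> // U _.
(* A finite downset is the union of the principal downsets of its elements; the initial [zero]
   contributes only [z], which every downset contains. *)
pose D s : B := foldr (fun c => @join B (principal c)) zero s.
have DP s x : x ⊩ D s <-> x = z \/ exists2 c, c \in s & x ≼ c.
  elim: s => [|c s IH]; first by rewrite in_zero; split=> [|[|[]]]//; left.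
  rewrite [D _]/(@join B (principal c) (D s)) in_join in_principal IH; split=> [[xc|[|[d ds xd]]]|].
  - by right; exists c; rewrite ?inE ?eqxx.
  - by left.
  - by right; exists d; rewrite // inE ds orbT.
  - case=> [|[d]]; first by right; left.
    by rewrite inE => /orP[/eqP->|ds xd]; [left|right; right; exists d].
have -> : U = D (enum (val (U : downset))).
  apply: downset_eqP => x; rewrite DP; split=> [xU|[->|[c]]].
  - by right; exists x; [rewrite mem_enum|apply: bsl_le_refl bsl x].
  - exact: downset_zero.
  - by rewrite mem_enum => cU xc; apply: in_down xc cU.
elim: (enum _) => [|c s IH]; first exact: closure_zero.
by apply: closure_join => //; apply: closure_core; exists c.
Qed.

Lemma principal_imp_join c (U V : B) :
  @imp B (principal c) (join U V) =
  join (@imp B (principal c) U) (@imp B (principal c) V).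
Proof.
(* The points below both [x] and [c] have a greatest one, [m x c], and a single point of a union
   lies in one of its parts. *)
have imp_principal (W : B) x : x ⊩ @imp B (principal c) W <-> m x c ⊩ W.
  have /(bsl_le_meet bsl)[le1 le2] := bsl_le_refl bsl (m x c).
  rewrite in_imp; split=> [|h y yx /in_principal yc].
    by apply=> //; apply/in_principal.
  by apply: in_down h; apply/(bsl_le_meet bsl).
by apply: downset_eqP => x; rewrite in_join !imp_principal in_join.
Qed.

Lemma downset_inquisitive : inquisitive_algebra B.
Proof.
split; rewrite ?downset_core_generated.
- split=> //.
  + by split=> [||*|*]; try split=> // *;
      apply: downset_eqP => ?; rewrite !(in_meet, in_join); tauto.
  + by move=> U _; apply/downset_leP => x /in_zero ->; apply: downset_zero.
  + move=> U V W _ _ _; rewrite !downset_leP; split=> h x.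
      move=> xU; apply/in_imp => y yx yV; apply: h; apply/in_meet; split=> //.
      exact: in_down yx xU.
    move=> /in_meet[/h /in_imp]; apply; exact: bsl_le_refl bsl x.
- split=> [|_ _ [c _ <-] [d _ <-]||U _|_ _ _ [a _ <-] [b _ <-] [c _ <-]].
  + split=> [_ _ [c _ <-] [d _ <-]|*|*|*];
      first by exists (m c d); rewrite // principal_meet.
    1-3: by apply: downset_eqP => ?; rewrite !in_meet; tauto.
  + by exists (i c d); rewrite // principal_imp.
  + by exists z.
  + by apply/downset_leP => x /in_zero ->; apply: downset_zero.
  + rewrite /meet_le -principal_imp -!principal_meet.
    have [_ _ _ _ res] := bsl.
    by split=> /principal_inj h; congr principal; apply/res.
- by move=> _ U V [c _ <-] _ _; apply: principal_imp_join.
Qed.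

Lemma downset_well_connected : well_connected B.
Proof.
move=> U V _ _ e.
(* A downset containing [top] is everything, so membership of [top] decides which disjunct is
   [one]. *)
have full (W : B) : top ⊩ W -> W = one.
  move=> topW; rewrite -principal_top; apply: downset_eqP => x.
  rewrite in_principal; split=> [_|xt]; first exact: bsl_le_top bsl x.
  exact: in_down xt topW.
have : top ⊩ join U V by rewrite e -principal_top; apply/in_principal/(bsl_le_refl bsl).
by move=> /in_join[] /full; [left|right].
Qed.

(** * Evaluation in the downset algebra and in [A], along an embedding [f] of [C] into the core of
    [A] *)

Section Evaluation.

Variables (A : inq_structure) (f : C -> A).
Hypotheses (f_inj : injective f) (f_core : forall c, core A (f c)).
Hypotheses (f_meet : {morph f : x y / m x y >-> meet x y})
  (f_imp : {morph f : x y / i x y >-> imp x y}) (f_zero : f z = zero).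

(** Without disjunctions, evaluation never leaves the core, and both [principal] and [f] commute
    with the core operations. *)
Lemma standard_eval (At : Type) (c : At -> C) (psi : form At) : standard psi ->
  exists2 d, eval (fun p => principal (c p) : B) psi = principal d
    & eval (fun p => f (c p)) psi = f d.
Proof.
elim: psi => //= [p|_|psi1 IH1 psi2 IH2|psi1 IH1 psi2 IH2].
- by exists (c p).
- by exists z.
- move=> /andP[/IH1[d1 -> ->] /IH2[d2 -> ->]].
  by exists (m d1 d2); rewrite ?principal_meet ?f_meet.
- move=> /andP[/IH1[d1 -> ->] /IH2[d2 -> ->]].
  by exists (i d1 d2); rewrite ?principal_imp ?f_imp.
Qed.

Lemma downset_core_valid (At : Type) (psi : form At) :
  standard psi -> core_valid A psi -> core_valid B psi.
Proof.
move=> psi_std A_psi mu mu_core.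
have /choice[c cE] : forall p, exists c, principal c = mu p.
  by move=> p; have [d _ <-] := mu_core p; exists d.
have -> : mu = fun p => principal (c p) by apply/funext => p; rewrite cE.
have [d -> dE] := standard_eval c psi_std; rewrite -principal_top.
congr principal; apply: f_inj.
by rewrite f_imp f_zero -dE; apply: A_psi => p; apply: f_core.
Qed.

Hypothesis A_inq : inquisitive_algebra A.

(* The disjunctive normal form: [x] is the join in [A] of a finite family of
   core elements generating the downset [U]. *)
Inductive join_of : B -> A -> Prop :=
| join_of_principal c : join_of (principal c) (f c)
| join_of_join U V x y :
    join_of U x -> join_of V y -> join_of (join U V) (join x y).

Local Notation S := (core_closure A).
Local Notation "x ⊑ y" := (meet_le meet x y) (at level 70).

Lemma join_of_closure U x : join_of U x -> S x.
Proof.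
elim=> [c|? ? ? ? _ ? _ ?]; first exact/closure_core/f_core.
exact: closure_join.
Qed.

Let A_hey : heyting_algebra_on S join meet imp zero.
Proof. by case: A_inq. Qed.

Let B_hey : heyting_algebra_on (core_closure B) join meet imp zero.
Proof. by case: downset_inquisitive. Qed.

Let B_closure (U : B) : core_closure B U.
Proof. by rewrite downset_core_generated. Qed.

Lemma join_of_meet U V x y :
  join_of U x -> join_of V y -> join_of (meet U V) (meet x y).
Proof.
move=> hU hV; have Sy := join_of_closure hV.
(* Distributivity is applied in parallel in the two algebras, first to the left argument and then to
   the right. *)
elim: hU => [c|U1 U2 x1 x2 h1 IH1 h2 IH2]; last first.
  rewrite (hey_meet_joinl B_hey) // (hey_meet_joinl A_hey) //;
    [exact: join_of_join|exact: join_of_closure h1|exact: join_of_closure h2].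
have Sc : S (f c) by exact/closure_core/f_core.
elim: hV {Sy} => [d|V1 V2 y1 y2 h1 IH1 h2 IH2].
  by rewrite -principal_meet -f_meet; apply: join_of_principal.
have [S1 S2] := (join_of_closure h1, join_of_closure h2).
rewrite (hey_meetC B_hey) // (hey_meetC A_hey) ?closure_join //; last first.
  exact: closure_join.
rewrite (hey_meet_joinl B_hey) // (hey_meet_joinl A_hey) //.
rewrite (hey_meetC B_hey (B_closure V1)) // (hey_meetC B_hey (B_closure V2)) //.
rewrite (hey_meetC A_hey S1) // (hey_meetC A_hey S2) //.
exact: join_of_join.
Qed.

(** A join in the antecedent becomes a meet of implications; once the antecedent is a core element,
    the split law, valid in both algebras, distributes over joins in the consequent. *)
Lemma join_of_imp U V x y :
  join_of U x -> join_of V y -> join_of (imp U V) (imp x y).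
Proof.
move=> hU hV; have Sy := join_of_closure hV.
elim: hU => [c|U1 U2 x1 x2 h1 IH1 h2 IH2]; last first.
  rewrite (hey_imp_joinl B_hey) // (hey_imp_joinl A_hey) //;
    [exact: join_of_meet|exact: join_of_closure h1|exact: join_of_closure h2].
have Sc : S (f c) by exact/closure_core/f_core.
elim: hV {Sy} => [d|V1 V2 y1 y2 h1 IH1 h2 IH2].
  by rewrite -principal_imp -f_imp; apply: join_of_principal.
rewrite principal_imp_join; have [_ _ ->] := A_inq; first exact: join_of_join.
- exact: f_core.
- exact: join_of_closure h1.
- exact: join_of_closure h2.
Qed.

Lemma join_of_eval (At : Type) (c : At -> C) (phi : form At) :
  join_of (eval (fun p => principal (c p) : B) phi) (eval (fun p => f (c p)) phi).
Proof.
elim: phi => /= [p||phi1 IH1 phi2 IH2|phi1 IH1 phi2 IH2|phi1 IH1 phi2 IH2].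
- exact: join_of_principal.
- by rewrite -f_zero; apply: join_of_principal.
- exact: join_of_meet.
- exact: join_of_join.
- exact: join_of_imp.
Qed.

Lemma join_of_ge U x c : join_of U x -> c ⊩ U -> f c ⊑ x.
Proof.
elim=> [d /in_principal cd|U1 U2 x1 x2 h1 IH1 h2 IH2].
  by rewrite /meet_le -f_meet cd.
have [S1 S2] := (join_of_closure h1, join_of_closure h2).
have S12 := closure_join S1 S2.
have [le1 le2] : x1 ⊑ join x1 x2 /\ x2 ⊑ join x1 x2.
  by apply/(hey_join_le A_hey) => //; exact: (hey_le_refl A_hey).
have Sc : S (f c) by exact/closure_core/f_core.
move=> /in_join[/IH1|/IH2] h; first exact: (hey_le_trans A_hey _ S1).
exact: (hey_le_trans A_hey _ S2).
Qed.

(** The downset [one] contains [top], so [x] lies above [f top], the greatest element. *)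
Lemma join_of_one x : join_of one x -> x = one.
Proof.
move=> h; have Sx := join_of_closure h.
have S0 : S zero by apply: closure_zero.
have S1 : S one by apply: closure_imp.
apply: (hey_le_antisym A_hey) => //.
  apply/(hey_le_imp A_hey) => //; rewrite (hey_meetC A_hey) //.
  have [_ _ _ zero_le _] := A_hey.
  by rewrite (zero_le x Sx); apply: (hey_le_refl A_hey).
rewrite /one -f_zero -f_imp; apply: join_of_ge h _.
by rewrite -principal_top; apply/in_principal/(bsl_le_refl bsl).
Qed.

Lemma downset_not_core_valid (At : Type) (c : At -> C) (phi : form At) :
  eval (fun p => f (c p)) phi <> one -> ~ core_valid B phi.
Proof.
move=> A_phi B_phi; apply: A_phi; apply: join_of_one.
rewrite -(B_phi (fun p => principal (c p))); first exact: join_of_eval.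
by move=> p; exists (c p).
Qed.

End Evaluation.

End DownsetStructure.

(** * The finite countermodel obtained from a refuting valuation *)

Fixpoint atoms (At : Type) (phi : form At) : seq At :=
  match phi with
  | Var p => [:: p]
  | Bot => [::]
  | And phi1 phi2 | Or phi1 phi2 | Imp phi1 phi2 => atoms phi1 ++ atoms phi2
  end.

Lemma eq_eval (At : eqType) (A : inq_structure) (mu nu : At -> A)
    (phi : form At) :
  {in atoms phi, mu =1 nu} -> eval mu phi = eval nu phi.
Proof.
elim: phi => /= [p h||phi1 IH1 phi2 IH2 h|phi1 IH1 phi2 IH2 h
    |phi1 IH1 phi2 IH2 h] //; first by apply: h; rewrite inE.
all: by rewrite IH1 ?IH2 // => p ps; apply: h; rewrite mem_cat ps ?orbT.
Qed.

Theorem theorem3p13 (At : countType) (Lambda : set (form At))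
    (Lambda_standard : forall psi : form At, Lambda psi -> standard psi)
    (Lambda_closed : standard_subst_closed Lambda)
    (A : inq_structure) (A_inq : inq_algebra_for Lambda A)
    (phi : form At) (A_phi : ~ core_valid A phi) :
  exists B : inq_structure,
    [/\ finite_set [set: B],
        core_generated B,
        well_connected B,
        inq_algebra_for Lambda B
      & ~ core_valid B phi].
Proof.
have [A_alg A_Lambda] := A_inq; have [_ A_bsl _] := A_alg.
have [[meetS _ _ _] impS zeroS _ _] := A_bsl.
have /existsNP[mu /not_implyP[mu_core mu_phi]] := A_phi.
(* The core as a type; [{classic _}] equips it with the choice structure needed for finite
   sequences. *)
pose T := {classic {x : A | core A x}}.
pose mT (x y : T) : T := exist _ _ (meetS _ _ (svalP x) (svalP y)).
pose iT (x y : T) : T := exist _ _ (impS _ _ (svalP x) (svalP y)).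
pose zT : T := exist _ _ zeroS.
have sval_inj : injective (sval : T -> A).
  by move=> [x xS] [y yS] /= e; apply: eq_exist.
have T_bsl : brouwerian_semilattice_on [set: T] mT iT zT.
  by apply: (brouwerian_semilattice_pullback sval_inj) A_bsl => // -[].
pose muT p : T := exist _ _ (mu_core p).
have /finite_seqP[s sE] :
    finite_set (generated mT iT zT [set` zT :: map muT (atoms phi)]).
  by apply: (finite_generated T_bsl); apply/finite_seqP; eexists.
set G := [set` _] in sE.
have sP x : (x \in s) <-> generated mT iT zT G x by rewrite sE.
pose C : finType := seq_sub s.
have mC_in (x y : C) : mT (val x) (val y) \in s.
  by apply/sP; apply: generated_meet; apply/sP/valP.
have iC_in (x y : C) : iT (val x) (val y) \in s.
  by apply/sP; apply: generated_imp; apply/sP/valP.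
have zC_in : zT \in s by apply/sP/generated_gen; rewrite /G /= inE eqxx.
pose mC (x y : C) := SeqSub (mC_in x y).
pose iC (x y : C) := SeqSub (iC_in x y).
pose zC := SeqSub zC_in.
pose f (x : C) : A := sval (val x).
have f_inj : injective f by move=> x y /sval_inj /val_inj.
have f_core x : core A (f x) by apply: svalP.
have fm : {morph f : x y / mC x y >-> meet x y} by [].
have fi : {morph f : x y / iC x y >-> imp x y} by [].
have fz : f zC = zero by [].
have C_bsl : brouwerian_semilattice_on [set: C] mC iC zC.
  by apply: (brouwerian_semilattice_pullback f_inj) A_bsl.
exists (downset_structure C_bsl); split.
- exact: finite_finset.
- exact: downset_core_generated.
- exact: downset_well_connected.
- split=> [|psi Lpsi]; first exact: downset_inquisitive.
  exact: (downset_core_valid f_inj f_core fm fi fz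
    (Lambda_standard _ Lpsi) (A_Lambda _ Lpsi)).
(* Atoms whose value is not in [s] are sent to [zC]; this cannot affect [phi], since the values of
   its atoms are among the generators. *)
- pose c p : C := insubd zC (muT p).
  apply: (downset_not_core_valid (c := c) f_core fm fi fz A_alg).
  suff <- : eval mu phi = eval (fun p => f (c p)) phi by [].
  apply: eq_eval => p p_phi; rewrite /f /c insubdK //.
  by apply/sP/generated_gen; rewrite /G /= inE map_f ?orbT.
Qed.
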